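(* Let $\phi\in\mathcal{A}$ and let $(c_1,c_2,\psi)\in H^1_{c,1}(\Omega)\times H^1_{c,2}(\Omega)\times H^1_g(\Omega)$ be the solution of the modified steady-state Poisson–Nernst–Planck system $$\int_\Omega D(\phi)(\nabla c_i+z_ic_i\nabla\psi-\alpha_0c_i\nabla\phi)\cdot\nabla s\,dx=0\quad\forall s\in H^1_{d,0}(\Omega),\ i=1,2,$$ $$\int_\Omega\epsilon(\phi)\nabla\psi\cdot\nabla\zeta-\Big(\sum_{i=1}^2z_ic_i\Big)\zeta\,dx=0\quad\forall\zeta\in H^1_{d,0}(\Omega).$$ Then the adjoint system (in the sense defined in the context) of the problem of minimizing $\mathcal{W}(\phi,\bm c(\phi))$ over $\phi\in\mathcal{A}$ subject to this system reads: find $\bm s=[s_1,s_2]^{\rm T}\in[H^1_{d,0}(\Omega)]^2$ and $\zeta\in H^1_{d,0}(\Omega)$ such that $$\int_\Omega D(\phi)\nabla s_i\cdot(\nabla q+z_iq\nabla\psi-\alpha_0q\nabla\phi)+z_iq-z_i\zeta q\,dx=0\quad\forall q\in H^1_{d,0}(\Omega),\ i=1,2,$$ $$\int_\Omega\epsilon(\phi)\nabla\zeta\cdot\nabla\eta\,dx+\sum_{i=1}^2\int_\Omega D(\phi)z_ic_i\nabla s_i\cdot\nabla\eta\,dx=0\quad\forall\eta\in H^1_{d,0}(\Omega).$$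
   Context: Setting. $\Omega\subset\mathbb{R}^d$, $d\in\{2,3\}$, is a bounded open domain with Lipschitz boundary $\partial\Omega=\overline{\Gamma_{\rm in}}\cup\overline{\Gamma_1}\cup\overline{\Gamma_2}$ (disjoint parts). $z_1=1$, $z_2=-1$; constants $D_0\gg D_m>0$, $\epsilon_m\gg\epsilon_0>0$, $\alpha_0\gg1$, $\kappa>0$, $p$ a positive integer, $V_0$ a target volume. $D(\phi)=D_m+\max\{\min\{\phi^p,1\},0\}(D_0-D_m)$, $\epsilon(\phi)=\epsilon_m+\max\{\min\{\phi^p,1\},0\}(\epsilon_0-\epsilon_m)$, $V(\phi)=\int_\Omega\max\{\min\{\phi,1\},0\}\,dx$, $\omega(\phi)=\frac14\phi^2(\phi-1)^2$. $\mathcal{A}=\{\phi\in W^{1,\infty}(\Omega):\phi|_{\Gamma_{\rm in}}=1,\ \phi|_{\Gamma_2}=0,\ V(\phi)=V_0\}$. Boundary data: $g\in H^2(\Omega)$ with $g|_{\Gamma_{\rm in}}=0$; $c_i^\infty\in H^2(\Omega)$ with $c_i^\infty|_{\Gamma_2}=0$. Spaces: $H^1_g(\Omega)=\{w\in H^1(\Omega):w=g\text{ on }\Gamma_{\rm in}\cup\Gamma_2\}$, $H^1_{c,i}(\Omega)=\{w\in H^1(\Omega):w=c_i^\infty\text{ on }\Gamma_{\rm in}\cup\Gamma_2\}$, $H^1_{d,0}(\Omega)=\{w\in H^1(\Omega):w=0\text{ on }\Gamma_{\rm in}\cup\Gamma_2\}$. Objective: $\mathcal{J}(\bm c)=-\sum_{i=1}^2\int_\Omega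 z_ic_i\,dx$ and $\mathcal{W}(\phi,\bm c)=\int_\Omega[\frac\kappa2|\nabla\phi|^2+\frac1\kappa\omega(\phi)]\,dx+\mathcal{J}(\bm c)$; $\bm c(\phi)=[c_1,c_2]^{\rm T}$ denotes the concentrations solving the state system for $\phi$. Lagrangian: for $w_i\in H^1_{c,i}(\Omega)$, $\tau\in H^1_g(\Omega)$, $\bm v=[v_1,v_2]^{\rm T}\in[H^1_{d,0}(\Omega)]^2$, $\xi\in H^1_{d,0}(\Omega)$, $$\mathcal{L}(\phi,\bm w,\bm v,\tau,\xi)=-\sum_{i=1}^2\int_\Omega z_iw_i\,dx-\sum_{i=1}^2\int_\Omega D(\phi)(\nabla w_i+z_iw_i\nabla\tau-\alpha_0w_i\nabla\phi)\cdot\nabla v_i\,dx-\int_\Omega\epsilon(\phi)\nabla\tau\cdot\nabla\xi-\Big(\sum_{i=1}^2z_iw_i\Big)\xi\,dx.$$ The adjoint system is, by definition, the system of conditions on $(\bm v,\xi)=(\bm s,\zeta)$ stating that the Gâteaux derivatives of $\mathcal{L}$ with respect to $\bm w$ and $\tau$, evaluated at $\bm w=\bm c$, $\tau=\psi$, $\bm v=\bm s$, $\xi=\zeta$, vanish in all directions $\delta_{\bm w}\in[H^1_{d,0}(\Omega)]^2$ and $\delta_\tau\in H^1_{d,0}(\Omega)$. All integrals appearing are understood to be well defined. *)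

(* Defs.v *)
From HB Require Import structures.
From mathcomp Require Import all_boot all_order all_algebra.
From mathcomp Require Import all_classical all_reals all_analysis.
Set Implicit Arguments.
Unset Strict Implicit.
Unset Printing Implicit Defensive.
Import Order.TTheory GRing.Theory Num.Theory.
Import numFieldNormedType.Exports.

Local Open Scope classical_set_scope.
Local Open Scope ring_scope.

(* Outer measure obtained from a gauge [rho] by countable covers with arbitrary
   sets (a gauge equal to +oo rules a covering set out). [mu_ext] asks for a
   semiring of sets; [all_sets T] makes every subset of [T] admissible. The empty
   set always has gauge 0. *)
Definition all_sets (T : Type) : Type := T.

Definition all_sets_display : measure_display.
Proof. by []. Qed.

Section all_sets_instance.
Variable T : pointedType.
HB.instance Definition _ := Pointed.on (all_sets T).
HB.instance Definition _ := @isMeasurable.Build all_sets_display (all_sets T)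
  (fun=> True) I (fun _ _ => I) (fun _ _ => I).
End all_sets_instance.

Section outer_measures.
Local Open Scope ereal_scope.
Variables (R : realType) (T : pointedType).

Definition gauge0 (rho : set T -> \bar R) (U : set T) : \bar R :=
  if U == set0 then 0 else rho U.

Definition cover_outer (rho : set T -> \bar R) : set T -> \bar R :=
  @mu_ext _ (all_sets T) R (gauge0 rho).

Variable rho : set T -> \bar R.
Hypothesis rho_ge0 : forall U, 0 <= rho U.

Lemma gauge0_0 : gauge0 rho set0 = 0.
Proof. by rewrite /gauge0 eqxx. Qed.

Lemma gauge0_ge0 U : 0 <= gauge0 rho U.
Proof. by rewrite /gauge0; case: ifP. Qed.

Lemma cover_outer0 : cover_outer rho set0 = 0.
Proof. exact: (@mu_ext0 _ (all_sets T) R _ gauge0_0 gauge0_ge0). Qed.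

Lemma cover_outer_ge0 A : 0 <= cover_outer rho A.
Proof. exact: (@mu_ext_ge0 _ (all_sets T) R _ gauge0_ge0). Qed.

Lemma le_cover_outer : {homo cover_outer rho : A B / A `<=` B >-> A <= B}.
Proof. exact: (@le_mu_ext _ (all_sets T) R). Qed.

Lemma cover_outer_sigma_subadditive : sigma_subadditive (cover_outer rho).
Proof. exact: (@mu_ext_sigma_subadditive _ (all_sets T) R _ gauge0_ge0). Qed.

End outer_measures.

Section euclidean.
Variables (R : realType) (d : nat).
Local Notation E := 'rV[R]_d.

Definition dot (u v : E) : R := \sum_i u ord0 i * v ord0 i.

(* The norm [`|_|] of the library on 'rV[R]_d is the sup norm. *)
Definition enorm (u : E) : R := Num.sqrt (dot u u).

Definition box (a b : E) : set E :=
  [set x | forall i, a ord0 i < x ord0 i <= b ord0 i].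

Definition box_vol (U : set E) : \bar R :=
  ereal_inf [set v | exists a b : E, [/\ forall i, a ord0 i <= b ord0 i,
    U = box a b & v = (\prod_i (b ord0 i - a ord0 i))%:E]].

Lemma box_vol_ge0 U : (0 <= box_vol U)%E.
Proof.
apply: le_ereal_inf_tmp => _ [a [b [ab _ ->]]].
by rewrite lee_fin; apply: prodr_ge0 => i _; rewrite subr_ge0.
Qed.

Definition lebesgue_outer : set E -> \bar R := cover_outer box_vol.

HB.instance Definition _ := isOuterMeasure.Build R E lebesgue_outer
  (cover_outer0 box_vol_ge0) (cover_outer_ge0 box_vol_ge0)
  (@le_cover_outer R E box_vol) (cover_outer_sigma_subadditive box_vol_ge0).

(* Lebesgue measure on R^d, on the sigma-algebra of Caratheodory-measurable sets *)
Definition leb_om : {outer_measure set E -> \bar R} := lebesgue_outer.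
Definition Leb : Type := caratheodory_type leb_om.
HB.instance Definition _ := Measurable.on Leb.
Definition leb : {measure set Leb -> \bar R} :=
  leb_om : set (caratheodory_type leb_om) -> \bar R.

Definition diam (U : set E) : \bar R :=
  ereal_sup [set v | v = 0%E \/
    exists x y, [/\ U x, U y & v = (enorm (x - y))%:E]].

Lemma diam_ge0 U : (0 <= diam U)%E.
Proof. by apply: ereal_sup_ubound; left. Qed.

Definition diam_gauge (s : nat) (delta : R) (U : set E) : \bar R :=
  if (diam U <= delta%:E)%E then (diam U ^+ s)%E else +oo%E.

Lemma diam_gauge_ge0 s delta U : (0 <= diam_gauge s delta U)%E.
Proof. by rewrite /diam_gauge; case: ifP => // _; exact/expe_ge0/diam_ge0. Qed.

(* s-dimensional Hausdorff measure, up to the usual normalizing constant *)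
Definition hausdorff_outer (s : nat) (A : set E) : \bar R :=
  ereal_sup [set cover_outer (diam_gauge s delta) A | delta in [set t : R | 0 < t]].

Section hausdorff.
Local Open Scope ereal_scope.
Variable s : nat.

Lemma cover_le_hausdorff (delta : R) (A : set E) : (0 < delta)%R ->
  cover_outer (diam_gauge s delta) A <= hausdorff_outer s A.
Proof. by move=> d0; apply: ereal_sup_ubound; exists delta. Qed.

Lemma hausdorff_outer0 : hausdorff_outer s set0 = 0.
Proof.
apply/eqP; rewrite eq_le; apply/andP; split.
  apply: ge_ereal_sup => _ [t _ <-].
  by rewrite cover_outer0//; exact: diam_gauge_ge0.
have := @cover_le_hausdorff 1 set0 ltr01.
by rewrite cover_outer0//; exact: diam_gauge_ge0.
Qed.

Lemma hausdorff_outer_ge0 A : 0 <= hausdorff_outer s A.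
Proof.
apply: le_trans (@cover_le_hausdorff 1 A ltr01).
exact/cover_outer_ge0/diam_gauge_ge0.
Qed.

Lemma le_hausdorff_outer :
  {homo hausdorff_outer s : A B / A `<=` B >-> A <= B}.
Proof.
move=> A B AB; apply: ge_ereal_sup => _ [t t0 <-].
exact: le_trans (le_cover_outer _ AB) (cover_le_hausdorff _ t0).
Qed.

Lemma hausdorff_outer_sigma_subadditive :
  sigma_subadditive (hausdorff_outer s).
Proof.
move=> A; apply: ge_ereal_sup => _ [t t0 <-].
apply: le_trans (cover_outer_sigma_subadditive (@diam_gauge_ge0 s t) A) _.
apply: lee_nneseries => [n _ _|n _].
  exact/cover_outer_ge0/diam_gauge_ge0.
exact: cover_le_hausdorff.
Qed.

HB.instance Definition _ := isOuterMeasure.Build R E (hausdorff_outer s)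
  hausdorff_outer0 hausdorff_outer_ge0 le_hausdorff_outer
  hausdorff_outer_sigma_subadditive.

End hausdorff.

(* The surface measure of dimension d - 1. Only its null sets and convergence in
   the associated L^2 matter below, so the normalization is irrelevant. *)
Definition surf_om : {outer_measure set E -> \bar R} := hausdorff_outer d.-1.
Definition Surf : Type := caratheodory_type surf_om.
HB.instance Definition _ := Measurable.on Surf.
Definition surf : {measure set Surf -> \bar R} :=
  surf_om : set (caratheodory_type surf_om) -> \bar R.

Definition boundary (A : set E) : set E := closure A `\` interior A.

(* Near each boundary point, in suitable orthonormal coordinates centred there,
   A is the region strictly above the graph of a Lipschitz function of the other
   d - 1 coordinates. *)
Definition lipschitz_boundary (A : set E) : Prop :=
  forall x0, boundary A x0 ->
  exists (Q : 'M[R]_d) (i : 'I_d) (r M : R) (gam : 'rV[R]_d.-1 -> R),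
  [/\ Q *m Q^T = 1%:M, 0 < r,
      forall a b, `|gam a - gam b| <= M * `|a - b| &
      forall y : E, enorm y < r ->
        (A (x0 + y *m Q) <-> gam (col' i y) < y ord0 i)].

Definition unit_vec (i : 'I_d) : E := delta_mx ord0 i.

Definition partial (i : 'I_d) (f : E -> R) : E -> R :=
  fun x => 'D_(unit_vec i) f x.

Definition classical_grad (f : E -> R) : E -> E :=
  fun x => \row_i partial i f x.

Fixpoint Ck (k : nat) (f : E -> R) : Prop :=
  continuous f /\
  if k is k'.+1 then
    forall i, (forall x, derivable f x (unit_vec i)) /\ Ck k' (partial i f)
  else True.

Definition smooth (f : E -> R) : Prop := forall k, Ck k f.

Section domain.
Variable Om : set E.

(* eta is in C_c^infty(Om), extended by zero. *)
Definition test_fun (eta : E -> R) : Prop :=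
  smooth eta /\
  exists K, [/\ compact K, K `<=` Om & forall x, ~ K x -> eta x = 0].

Definition integrable_on (f : E -> R) : Prop :=
  leb.-integrable Om (EFin \o f).

Definition integral_on (f : E -> R) : R := (\int[leb]_(x in Om) f x)%R.

(* "int_Om f dx is well defined and vanishes" *)
Definition integral_eq0 (f : E -> R) : Prop :=
  integrable_on f /\ integral_on f = 0.

Definition L2 (f : E -> R) : Prop :=
  measurable_fun (Om : set Leb) (f : Leb -> R) /\
  integrable_on (fun x => f x ^+ 2).

Definition Linf (f : E -> R) : Prop :=
  measurable_fun (Om : set Leb) (f : Leb -> R) /\
  exists M : R, {ae leb, forall x, Om x -> `|f x| <= M}.

Definition weak_gradient (u : E -> R) (G : E -> E) : Prop :=
  forall eta, test_fun eta -> forall i,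
    integral_on (fun x => u x * partial i eta x) =
    - integral_on (fun x => G x ord0 i * eta x).

(* A Sobolev function is a pair (u, G) of a function and a representative G of
   its weak gradient. As G is determined by u almost everywhere on Om, this adds
   nothing to u; it makes the gradient a linear operation on all of [sob]. *)
Definition sob : Type := ((E -> R) * (E -> E))%type.
HB.instance Definition _ := GRing.Lmodule.on sob.

Definition fval (u : sob) : E -> R := u.1.
Definition grad (u : sob) : E -> E := u.2.

Definition H1 (u : sob) : Prop :=
  [/\ L2 (fval u), forall i, L2 (fun x => grad u x ord0 i) &
      weak_gradient (fval u) (grad u)].

Definition H2 (u : sob) : Prop :=
  H1 u /\ forall i, exists G : E -> E, H1 ((fun x => grad u x ord0 i), G).

Definition W1inf (u : sob) : Prop :=
  [/\ Linf (fval u), forall i, Linf (fun x => grad u x ord0 i) &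
      weak_gradient (fval u) (grad u)].

(* h represents the trace of u in L^2(boundary Om), the trace operator being the
   continuous extension to H^1(Om) of the restriction of smooth functions. *)
Definition is_trace (u : sob) (h : E -> R) : Prop :=
  measurable_fun (boundary Om : set Surf) (h : Surf -> R) /\
  exists un : nat -> E -> R,
  [/\ forall n, smooth (un n),
      (\int[leb]_(x in Om) ((un n x - fval u x) ^+ 2)%:E)%E @[n --> \oo] --> 0%E,
      (\int[leb]_(x in Om)
        (enorm (classical_grad (un n) x - grad u x) ^+ 2)%:E)%E
        @[n --> \oo] --> 0%E &
      (\int[surf]_(x in boundary Om) ((un n x - h x) ^+ 2)%:E)%E
        @[n --> \oo] --> 0%E].

(* u = f on Gam in the sense of traces, surf-almost everywhere *)
Definition trace_eq (Gam : set E) (u : sob) (f : E -> R) : Prop :=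
  exists h, is_trace u h /\ surf (Gam `&` [set x | h x <> f x]) = 0%E.

Definition same_trace (Gam : set E) (u v : sob) : Prop :=
  exists h, is_trace v h /\ trace_eq Gam u h.

End domain.

End euclidean.

Section gateaux.
Variables (R : realType) (V : lmodType R).

(* The Gateaux derivative at x, in the direction v, of the functional F defined
   on [def] exists and is equal to l. *)
Definition is_gateaux (def : set V) (F : V -> R) (x v : V) (l : R) : Prop :=
  (\forall t \near (0 : R), def (x + t *: v)) /\
  (fun t : R => t^-1 * (F (x + t *: v) - F x)) @ (0 : R)^' --> l.

End gateaux.

Record pnp_data (R : realType) (d : nat) := PnpData {
  Om : set 'rV[R]_d;
  Gin : set 'rV[R]_d;
  Gam1 : set 'rV[R]_d;
  Gam2 : set 'rV[R]_d;
  D0 : R;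
  Dm : R;
  eps0 : R;
  epsm : R;
  alpha0 : R;
  kappa : R;
  ppow : nat;
  V0 : R;
  gbd : sob R d;
  cbd : 'I_2 -> sob R d
}.

Section pnp.
Variables (R : realType) (d : nat) (P : pnp_data R d).
Local Notation E := 'rV[R]_d.
Local Notation sob := (sob R d).
Local Notation Om := (Om P).

(* "D0 >> Dm", "epsm >> eps0" and "alpha0 >> 1" are read as strict inequalities. *)
Record pnp_hyp : Prop := PnpHyp {
  Om_nonempty : Om !=set0;
  Om_open : open Om;
  Om_connected : connected Om;
  Om_bounded : bounded_set Om;
  Om_lipschitz : lipschitz_boundary Om;
  boundary_parts :
    boundary Om = closure (Gin P) `|` closure (Gam1 P) `|` closure (Gam2 P);
  Gin_Gam1 : Gin P `&` Gam1 P = set0;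
  Gin_Gam2 : Gin P `&` Gam2 P = set0;
  Gam1_Gam2 : Gam1 P `&` Gam2 P = set0;
  Dm_gt0 : 0 < Dm P;
  Dm_lt_D0 : Dm P < D0 P;
  eps0_gt0 : 0 < eps0 P;
  eps0_lt_epsm : eps0 P < epsm P;
  alpha0_gt1 : 1 < alpha0 P;
  kappa_gt0 : 0 < kappa P;
  pow_gt0 : (0 < ppow P)%N;
  gbd_H2 : H2 Om (gbd P);
  gbd_in : trace_eq Om (Gin P) (gbd P) (fun=> 0);
  cbd_H2 : forall i, H2 Om (cbd P i);
  cbd_2 : forall i, trace_eq Om (Gam2 P) (cbd P i) (fun=> 0)
}.

(* z_1 = 1 and z_2 = -1, with the species numbered from 0 *)
Definition z (i : 'I_2) : R := if i == ord0 then 1 else -1.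

Definition clip (a : R) : R := Num.max (Num.min a 1) 0.

Definition Dcoef (phi : sob) (x : E) : R :=
  Dm P + clip (fval phi x ^+ ppow P) * (D0 P - Dm P).

Definition epscoef (phi : sob) (x : E) : R :=
  epsm P + clip (fval phi x ^+ ppow P) * (eps0 P - epsm P).

Definition volume (phi : sob) : R := integral_on Om (fun x => clip (fval phi x)).

Definition admissible (phi : sob) : Prop :=
  [/\ W1inf Om phi, trace_eq Om (Gin P) phi (fun=> 1),
      trace_eq Om (Gam2 P) phi (fun=> 0) & volume phi = V0 P].

Definition Gdir : set E := Gin P `|` Gam2 P.

Definition H1g (w : sob) : Prop := H1 Om w /\ same_trace Om Gdir w (gbd P).

Definition H1c (i : 'I_2) (w : sob) : Prop :=
  H1 Om w /\ same_trace Om Gdir w (cbd P i).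

Definition H1d0 (w : sob) : Prop := H1 Om w /\ trace_eq Om Gdir w (fun=> 0).

(* grad w + z_i w grad psi - alpha0 w grad phi *)
Definition flux (i : 'I_2) (phi w psi : sob) (x : E) : E :=
  grad w x + (z i * fval w x) *: grad psi x - (alpha0 P * fval w x) *: grad phi x.

Definition charge_density (c : 'I_2 -> sob) (x : E) : R :=
  \sum_(i < 2) z i * fval (c i) x.

Definition state_system (phi : sob) (c : 'I_2 -> sob) (psi : sob) : Prop :=
  [/\ forall i, H1c i (c i), H1g psi,
      forall i s, H1d0 s ->
        integral_eq0 Om (fun x =>
          Dcoef phi x * dot (flux i phi (c i) psi x) (grad s x)) &
      forall zeta, H1d0 zeta ->
        integral_eq0 Om (fun x =>
          epscoef phi x * dot (grad psi x) (grad zeta x)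
          - charge_density c x * fval zeta x)].

Definition Jobj (c : 'I_2 -> sob) : R :=
  - \sum_(i < 2) integral_on Om (fun x => z i * fval (c i) x).

Definition double_well (a : R) : R := 4%:R^-1 * a ^+ 2 * (a - 1) ^+ 2.

(* The objective. Its first term involves phi alone and does not enter the
   Lagrangian, whose derivatives are taken in w and tau only. *)
Definition Wobj (phi : sob) (c : 'I_2 -> sob) : R :=
  integral_on Om (fun x => kappa P / 2 * enorm (grad phi x) ^+ 2
                           + (kappa P)^-1 * double_well (fval phi x))
  + Jobj c.

Definition lagr_flux (phi : sob) (w v : 'I_2 -> sob) (tau : sob)
    (i : 'I_2) (x : E) : R :=
  Dcoef phi x * dot (flux i phi (w i) tau x) (grad (v i) x).

Definition lagr_poisson (phi : sob) (w : 'I_2 -> sob) (tau xi : sob) (x : E) : R :=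
  epscoef phi x * dot (grad tau x) (grad xi x) - charge_density w x * fval xi x.

Definition lagrangian (phi : sob) (w v : 'I_2 -> sob) (tau xi : sob) : R :=
  Jobj w
  - \sum_(i < 2) integral_on Om (lagr_flux phi w v tau i)
  - integral_on Om (lagr_poisson phi w tau xi).

Definition lagrangian_defined (phi : sob) (w v : 'I_2 -> sob) (tau xi : sob) :
    Prop :=
  [/\ forall i, integrable_on Om (fun x => z i * fval (w i) x),
      forall i, integrable_on Om (lagr_flux phi w v tau i) &
      integrable_on Om (lagr_poisson phi w tau xi)].

Definition adjoint_system (phi : sob) (c : 'I_2 -> sob) (psi : sob)
    (s : 'I_2 -> sob) (zeta : sob) : Prop :=
  (forall dw : 'I_2 -> sob, (forall i, H1d0 (dw i)) ->
     is_gateaux (fun w => lagrangian_defined phi w s psi zeta)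
       (fun w => lagrangian phi w s psi zeta) c dw 0) /\
  (forall dtau : sob, H1d0 dtau ->
     is_gateaux (fun tau => lagrangian_defined phi c s tau zeta)
       (fun tau => lagrangian phi c s tau zeta) psi dtau 0).

End pnp.

(* Main.v *)
(* The Lagrangian L is affine in w and in tau separately, so along a line its
   difference quotient does not depend on t and the Gateaux derivative is that
   constant; collecting terms gives the two adjoint equations.  The integrability
   half of each equation is read off the fact that L is defined at two points of
   the line: the integrands are affine in t, so their slopes are integrable.
   Conversely the state system and the L^2 bounds make L defined at (c, psi).
   All of this needs Omega to be Caratheodory measurable of finite measure, which
   holds because half-spaces split boxes into boxes of the same total volume and
   open sets are countable unions of rational boxes. *)
Require Import Defs.
From mathcomp Require Import all_boot all_order all_algebra.
From mathcomp Require Import all_classical all_reals all_analysis.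
From mathcomp Require Import measurable_realfun ring lra.
Import Order.TTheory GRing.Theory Num.Theory.
Set Implicit Arguments.
Unset Strict Implicit.
Unset Printing Implicit Defensive.
Import numFieldNormedType.Exports.
Local Open Scope classical_set_scope.
Local Open Scope ring_scope.

(** * Outer measures from countable covers: comparison with the gauge and splitting *)

Section CaratheodoryCovers.
Local Open Scope ereal_scope.
Variables (R : realType) (T : pointedType) (rho : set T -> \bar R).
Hypothesis rho_ge0 : forall U, 0 <= rho U.

(** Cover [U] by itself followed by empty sets, whose gauge is 0. *)
Lemma cover_outer_le_gauge (U : set T) : cover_outer rho U <= gauge0 rho U.
Proof.
apply: ereal_inf_lbound; exists (fun n => if n is 0%N then U else set0).
  by split=> // x Ux; exists 0%N.
rewrite nneseries_recl//=; last by move=> n _; exact: gauge0_ge0.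
rewrite eseries0 ?adde0// => -[//|i] _ _.
exact: gauge0_0.
Qed.

(** Reduces the Caratheodory condition for [H] to the gauge: tracing any cover of [X] on [H] and on
    its complement covers the two pieces, and the two series of gauges are compared with the
    original one term by term. *)
Lemma cover_outer_split (H X : set T) :
  (forall U, gauge0 rho (U `&` H) + gauge0 rho (U `&` ~` H) <= gauge0 rho U) ->
  cover_outer rho (X `&` H) + cover_outer rho (X `&` ~` H) <= cover_outer rho X.
Proof.
move=> split_gauge; apply: le_ereal_inf_tmp => _ [A [_ XA] <-].
have inter_le B : cover_outer rho (X `&` B) <=
    \sum_(k <oo) gauge0 rho (A k `&` B).
  apply: ereal_inf_lbound; exists (fun k => A k `&` B) => //.
  by split=> // x [/XA[k _ Akx] Bx]; exists k.
apply: le_trans (leeD (inter_le H) (inter_le (~` H))) _.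
rewrite -nneseriesD; try by move=> *; exact: gauge0_ge0.
apply: lee_nneseries => [k _ _|k _]; last exact: split_gauge.
by rewrite adde_ge0//; exact: gauge0_ge0.
Qed.

End CaratheodoryCovers.

(** * Lebesgue measure: open sets are measurable, bounded sets have finite measure *)

Section LebesgueOpen.
Variables (R : realType) (d : nat).
Local Notation E := 'rV[R]_d.

Definition set_coord (a : E) (i : 'I_d) (r : R) : E :=
  \row_j if j == i then r else a ord0 j.

Lemma gauge0_box_le (a b : E) : (forall i, a ord0 i <= b ord0 i) ->
  (gauge0 (@box_vol R d) (box a b) <= (\prod_i (b ord0 i - a ord0 i))%:E)%E.
Proof.
move=> ab; rewrite /gauge0; case: ifP => _.
  by rewrite lee_fin prodr_ge0// => i _; rewrite subr_ge0.
by apply: ereal_inf_lbound; exists a, b.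
Qed.

Definition halfspace (i : 'I_d) (r : R) : set E := [set x | x ord0 i <= r].

(** Boxes are closed on the same side as the half-space, so the hyperplane cuts a box into two boxes
    with no face left over, and their volumes add up. A nonempty set that is not a box has infinite
    gauge. *)
Lemma gauge0_box_vol_split (i : 'I_d) (r : R) (U : set E) :
  (gauge0 (@box_vol R d) (U `&` halfspace i r) +
   gauge0 (@box_vol R d) (U `&` ~` halfspace i r) <=
   gauge0 (@box_vol R d) U)%E.
Proof.
have [->|U0] := eqVneq U set0; first by rewrite !set0I gauge0_0 adde0.
rewrite [leRHS]/gauge0 (negbTE U0); apply: le_ereal_inf_tmp => _ [a [b [ab -> ->]]].
(* Three positions of the hyperplane: below the box, above it, or strictly between its two faces
   orthogonal to direction [i]. *)
have [ra|ar] := leP r (a ord0 i).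
  rewrite (_ : _ `&` halfspace i r = set0); last first.
    apply/seteqP; split=> // x [/(_ i)/andP[ax _] /= xr].
    by have := le_lt_trans ra ax; rewrite ltNge xr.
  rewrite gauge0_0 add0e (_ : _ `&` _ = box a b); first exact: gauge0_box_le.
  apply/seteqP; split=> [x []//|x axb]; split=> //= xr.
  have /andP[ax _] := axb i.
  by have := le_lt_trans ra ax; rewrite ltNge xr.
have [br|rb] := leP (b ord0 i) r.
  rewrite [X in (_ + gauge0 _ X)%E](_ : _ = set0); last first.
    by apply/seteqP; split=> // x [/(_ i)/andP[_ xb] /=]; case; exact: le_trans xb br.
  rewrite gauge0_0 adde0 (_ : _ `&` _ = box a b); first exact: gauge0_box_le.
  apply/seteqP; split=> [x []//|x axb]; split=> //=.
  by have /andP[_ xb] := axb i; exact: le_trans xb br.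
have -> : box a b `&` halfspace i r = box a (set_coord b i r).
  apply/seteqP; split=> [x [axb xr] j|x axb].
    rewrite mxE; case: eqP => [->|_]; last exact: axb.
    by have /andP[-> _] := axb i.
  have /andP[axi xri] := axb i; rewrite mxE eqxx in xri.
  split=> // j; have := axb j; rewrite mxE; case: eqP => // -> /andP[-> _] /=.
  exact: le_trans xri (ltW rb).
have -> : box a b `&` ~` halfspace i r = box (set_coord a i r) b.
  apply/seteqP; split=> [x [axb /negP xr] j|x axb].
    rewrite mxE; case: eqP => [->|_]; last exact: axb.
    by have /andP[_ ->] := axb i; rewrite ltNge xr.
  have /andP[rxi xbi] := axb i; rewrite mxE eqxx in rxi.
  split=> [j|/=]; last by apply/negP; rewrite -ltNge.
  have := axb j; rewrite mxE; case: eqP => // -> /andP[_ ->].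
  by rewrite (lt_trans ar rxi).
apply: le_trans (leeD (gauge0_box_le _) (gauge0_box_le _)) _.
- by move=> j; rewrite mxE; case: eqP => // ->; exact: ltW.
- by move=> j; rewrite mxE; case: eqP => // ->; exact: ltW.
(* The three products share every factor except the [i]-th, where
   [(r - a_i) + (b_i - r) = b_i - a_i]. *)
rewrite -EFinD lee_fin (bigD1 i)//= [X in _ + X](bigD1 i)//= [leRHS](bigD1 i)//=.
rewrite !mxE eqxx.
rewrite (eq_bigr (fun j => b ord0 j - a ord0 j)); last first.
  by move=> j /negbTE ji; rewrite mxE ji.
rewrite [X in _ + _ * X](eq_bigr (fun j => b ord0 j - a ord0 j)); last first.
  by move=> j /negbTE ji; rewrite mxE ji.
by rewrite -mulrDl addrC addrA subrK.
Qed.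

(** One inequality of the Caratheodory criterion is subadditivity; the other descends from the
    gauge. *)
Lemma leb_measurable_halfspace (i : 'I_d) (r : R) :
  measurable (halfspace i r : set (Leb R d)).
Proof.
apply: le_caratheodory_measurable => X.
exact: (cover_outer_split (@box_vol_ge0 R d) X (gauge0_box_vol_split i r)).
Qed.

Lemma leb_measurable_box (a b : E) : measurable (box a b : set (Leb R d)).
Proof.
rewrite (_ : box a b = \bigcap_(i in [set: 'I_d])
    (~` halfspace i (a ord0 i) `&` halfspace i (b ord0 i))).
  apply: fin_bigcap_measurable => [|i _]; first by [].
  apply: measurableI; last exact: leb_measurable_halfspace.
  exact/measurableC/leb_measurable_halfspace.
apply/seteqP; split=> x /=.
  move=> axb i _; have /andP[ax xb] := axb i; split=> //=.
  by apply/negP; rewrite -ltNge.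
by move=> axb i; have [/negP + xb] := axb i I; rewrite -ltNge => ->.
Qed.

Lemma leb_measurable_open (U : set E) : open U -> measurable (U : set (Leb R d)).
Proof.
move=> oU.
pose ratv (q : 'rV[rat]_d) : E := map_mx ratr q.
(* Rational boxes not contained in [U] are replaced by the empty set, so that the union runs over a
   whole countable type. *)
rewrite (_ : U = \bigcup_(q : 'rV[rat]_d * 'rV[rat]_d)
   (if `[< box (ratv q.1) (ratv q.2) `<=` U >]
    then box (ratv q.1) (ratv q.2) else set0)); last first.
  apply/seteqP; split=> [x Ux|x [q _]]; last by case: asboolP => // qU /qU.
  have /nbhs_ballP[e /= e0 xeU] := open_nbhs_nbhs (conj oU Ux).
  (* Rational corners within [e] of [x] on either side, coordinate by coordinate: the resulting box
     lies in the sup-norm ball of radius [e]. *)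
  have /choice[p pP] i : exists q : rat, ratr q \in `]x ord0 i - e, x ord0 i[.
    by apply: rat_in_itvoo; rewrite ltrBlDr ltrDl.
  have /choice[q qP] i : exists q : rat, ratr q \in `]x ord0 i, x ord0 i + e[.
    by apply: rat_in_itvoo; rewrite ltrDl.
  exists (\row_i p i, \row_i q i) => //=; rewrite asboolT => [i|y pyq].
    rewrite !mxE; have := pP i; have := qP i; rewrite !in_itv/=.
    by move=> /andP[/ltW -> _] /andP[_ ->].
  apply: xeU; split=> // k i; rewrite /ball/= ord1.
  have := pyq i; rewrite !mxE; have := pP i; have := qP i; rewrite !in_itv/=.
  move=> /andP[_ qe] /andP[pe _] /andP[py yq].
  by rewrite ltr_distlC (lt_trans pe py) (le_lt_trans yq qe).
apply: countable_bigcupT_measurable => // q.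
by case: ifP => // _; exact: leb_measurable_box.
Qed.

Lemma leb_bounded_lty (U : set E) : bounded_set U -> (leb R d U < +oo)%E.
Proof.
(* Boundedness only gives bounds strictly above [M]; the maximum with 0 keeps [K] nonnegative. *)
move=> [M [_ UM]]; pose K := Num.max M 0 + 1.
have K0 : 0 <= K by rewrite addr_ge0// le_max lexx orbT.
have {}UM x : U x -> `|x| <= K.
  by apply: UM; rewrite ltr_pwDr// le_max lexx.
(* Boxes are open on the left, so the lower corner must lie strictly below [- K]. *)
pose a : E := const_mx (- K - 1); pose b : E := const_mx K.
have Uab : U `<=` box a b.
  move=> x Ux i; rewrite !mxE.
  have xK : `|x ord0 i| <= K.
    apply: le_trans (UM x Ux); rewrite [leRHS]/Num.norm/= mx_normrE.
    by apply/bigmax_geP; right; exists (ord0, i).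
  move: xK; rewrite ler_norml => /andP[Kx ->]; rewrite andbT.
  by rewrite (lt_le_trans _ Kx)// ltrBlDr ltrDl.
apply: le_lt_trans (le_cover_outer _ Uab) _.
apply: le_lt_trans (cover_outer_le_gauge (@box_vol_ge0 R d) _) _.
apply: le_lt_trans (gauge0_box_le _) (ltry _) => i.
by rewrite !mxE; lra.
Qed.

End LebesgueOpen.

(** * Linearity of the integral and products of square-integrable functions *)

Section IntegrableOn.
Variables (R : realType) (d : nat) (U : set 'rV[R]_d).
Hypothesis measurable_U : measurable (U : set (Leb R d)).
Implicit Types (f g : 'rV[R]_d -> R) (k : R).

Lemma integrable_on0 : integrable_on U (fun=> 0).
Proof. by rewrite /integrable_on (_ : EFin \o _ = cst 0%E)//; exact: integrable0. Qed.

Lemma integrable_onD f g : integrable_on U f -> integrable_on U g ->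
  integrable_on U (fun x => f x + g x).
Proof. by move=> fU gU; exact: (integrableD measurable_U fU gU). Qed.

Lemma integrable_onZ k f : integrable_on U f -> integrable_on U (fun x => k * f x).
Proof. by move=> fU; exact: (integrableZl measurable_U k fU). Qed.

Lemma integrable_onB f g : integrable_on U f -> integrable_on U g ->
  integrable_on U (fun x => f x - g x).
Proof. by move=> fU gU; exact: (integrableB measurable_U fU gU). Qed.

(** Recovers the slope of an affine integrand from two of its values: [g] is the difference
    quotient. *)
Lemma integrable_on_increment k f g : k != 0 -> integrable_on U f ->
  integrable_on U (fun x => f x + k * g x) -> integrable_on U g.
Proof.
move=> k0 fU fgU.
rewrite (_ : g = fun x => k^-1 * ((f x + k * g x) - f x)).
  exact/integrable_onZ/integrable_onB.
by apply/funext => x; rewrite addrC addKr mulKf.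
Qed.

Lemma integrable_on_sum n (f : 'I_n -> 'rV[R]_d -> R) :
  (forall i, integrable_on U (f i)) ->
  integrable_on U (fun x => \sum_(i < n) f i x).
Proof.
elim: n f => [|n IH] f fU.
  under eq_fun do rewrite big_ord0; exact: integrable_on0.
under eq_fun do rewrite big_ord_recl.
by apply: integrable_onD => //; exact: IH.
Qed.

Lemma integral_onD f g : integrable_on U f -> integrable_on U g ->
  integral_on U (fun x => f x + g x) = integral_on U f + integral_on U g.
Proof. exact: RintegralD. Qed.

Lemma integral_onZ k f : integrable_on U f ->
  integral_on U (fun x => k * f x) = k * integral_on U f.
Proof. exact: RintegralZl. Qed.

Lemma integral_onB f g : integrable_on U f -> integrable_on U g ->
  integral_on U (fun x => f x - g x) = integral_on U f - integral_on U g.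
Proof. exact: RintegralB. Qed.

Lemma integral_on0 : integral_on U (fun=> 0) = 0.
Proof. by rewrite /integral_on Rintegral_cst// mul0r. Qed.

Lemma integral_on_sum n (f : 'I_n -> 'rV[R]_d -> R) :
  (forall i, integrable_on U (f i)) ->
  integral_on U (fun x => \sum_(i < n) f i x) = \sum_(i < n) integral_on U (f i).
Proof.
elim: n f => [|n IH] f fU.
  by rewrite big_ord0; under eq_fun do rewrite big_ord0; exact: integral_on0.
rewrite big_ord_recl -IH// -integral_onD//; last exact: integrable_on_sum.
by congr integral_on; apply/funext => x; rewrite big_ord_recl.
Qed.

Lemma integrable_on_affine k f g : integrable_on U f -> integrable_on U g ->
  integrable_on U (fun x => f x + k * g x).
Proof. by move=> fU gU; exact/integrable_onD/integrable_onZ. Qed.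

Lemma integral_on_affine k f g : integrable_on U f -> integrable_on U g ->
  integral_on U (fun x => f x + k * g x) = integral_on U f + k * integral_on U g.
Proof.
move=> fU gU; rewrite integral_onD ?integral_onZ//; exact: integrable_onZ.
Qed.

(** Domination by [f ^+ 2 + g ^+ 2]. *)
Lemma L2_mul_integrable f g : L2 U f -> L2 U g ->
  integrable_on U (fun x => f x * g x).
Proof.
move=> [mf f2] [mg g2].
apply: (le_integrable measurable_U _ _ (integrable_onD f2 g2)) => [|x Ux].
  exact/measurable_EFinP/measurable_funM.
rewrite /= lee_fin [leRHS]ger0_norm ?addr_ge0 ?sqr_ge0//.
by rewrite ler_norml; have := sqr_ge0 (f x + g x); have := sqr_ge0 (f x - g x);
  have := sqr_ge0 (f x); have := sqr_ge0 (g x); nra.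
Qed.

(** On a set of finite measure the constant 1 is square integrable, and [f] is its product with
    1. *)
Lemma L2_integrable f : (leb R d U < +oo)%E -> L2 U f -> integrable_on U f.
Proof.
move=> Uoo fL2; rewrite (_ : f = fun x => 1 * f x); last first.
  by apply/funext => x; rewrite mul1r.
apply: L2_mul_integrable fL2; split; first exact: measurable_cst.
apply/integrableP; split; first exact: measurable_cst.
rewrite (eq_integral (cst 1%:E)) => [|x _]; last first.
  by rewrite /= expr1n normr1.
by rewrite integral_cst// mul1e.
Qed.

End IntegrableOn.

(** * The zero function as a test direction *)

Section ZeroSobolev.
Variables (R : realType) (d : nat).

Lemma smooth0 : smooth (fun _ : 'rV[R]_d => 0 : R).
Proof.
elim=> [|k IH] /=; first by split=> //; exact: cst_continuous.
split; first exact: cst_continuous.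
move=> i; split=> [x|]; first exact: derivable_cst.
rewrite (_ : partial i _ = fun=> 0)//.
by apply/funext => x; exact: derive_cst.
Qed.

Lemma classical_grad0 : classical_grad (fun _ : 'rV[R]_d => 0 : R) = fun=> 0.
Proof.
apply/funext => x; apply/rowP => i; rewrite !mxE.
exact: derive_cst.
Qed.

(** Serves to perturb one species while the other is kept fixed. The zero trace is witnessed by the
    constant sequence of zero functions. *)
Lemma H1d0_0 (P : pnp_data R d) : measurable (Om P : set (Leb R d)) ->
  H1d0 P (0 : sob R d).
Proof.
move=> mOm.
have L20 : L2 (Om P) (fun=> 0).
  split; first exact: measurable_cst.
  by under eq_fun do rewrite expr0n; exact: integrable_on0.
have enorm0 : enorm (0 - 0 : 'rV[R]_d) ^+ 2 = 0.
  rewrite /enorm /dot big1 ?sqrtr0 ?expr0n// => i _.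
  by rewrite subr0 mxE mul0r.
split.
  split=> // [i|eta _ i].
    by rewrite (_ : (fun x => _) = fun=> 0)//; apply/funext => x; exact: mxE.
  rewrite (_ : (fun x => _) = fun=> 0); last by apply/funext => x; rewrite mul0r.
  rewrite integral_on0// (_ : (fun x => _) = fun=> 0) ?integral_on0 ?oppr0//.
  by apply/funext => x; rewrite mxE mul0r.
exists (fun=> 0); split; last first.
  rewrite (_ : _ `&` _ = set0) ?measure0//.
  by apply/seteqP; split=> // x [].
split; first exact: measurable_cst.
exists (fun _ _ => 0); split=> [n| | |]; first exact: smooth0.
- apply: cvg_near_cst; apply: nearW => n; apply: integral0_eq => x _.
  by rewrite subr0 expr0n.
- apply: cvg_near_cst; apply: nearW => n; apply: integral0_eq => x _.
  by rewrite classical_grad0 enorm0.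
- apply: cvg_near_cst; apply: nearW => n; apply: integral0_eq => x _.
  by rewrite subr0 expr0n.
Qed.

End ZeroSobolev.

(** * Gateaux derivatives of functionals that are affine along a line *)

Section GateauxAffine.
Variables (R : realType) (V : lmodType R) (def : set V) (F : V -> R) (x v : V).

(** The derivative presupposes definedness on some interval around 0; half of its radius is a
    nonzero parameter inside. *)
Lemma is_gateaux_def l : is_gateaux def F x v l ->
  exists2 t, t != 0 & def (x + t *: v).
Proof.
move=> [/nbhs_ballP[e /= e0 edef] _].
exists (e / 2); first by rewrite gt_eqF// divr_gt0.
by apply: edef; rewrite /ball/= sub0r normrN gtr0_norm ?divr_gt0//
  ltr_pdivrMr// ltr_pMr// ltr1n.
Qed.

(** The difference quotient equals [k] for every nonzero [t], and limits in [R] are unique. *)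
Lemma is_gateaux_affine k l : (forall t, def (x + t *: v)) ->
  (forall t, F (x + t *: v) = F x + t * k) ->
  is_gateaux def F x v l <-> l = k.
Proof.
move=> defv Fv.
have quot : (fun t => t^-1 * (F (x + t *: v) - F x)) t @[t --> (0 : R)^'] --> k.
  apply: cvg_near_cst; near=> t.
  rewrite Fv addrC addKr mulKf//.
  near: t; exact: nbhs_dnbhs_neq.
split=> [[_ lim]|->]; first exact: (cvg_unique _ lim quot).
by split=> //; near=> t; exact: defv.
Unshelve. all: by end_near. Qed.

End GateauxAffine.

(** * Slopes of the Lagrangian in the concentrations and in the potential *)

Section LagrangianDerivatives.
Variables (R : realType) (d : nat) (P : pnp_data R d).
Local Notation sob := (sob R d).
Hypothesis measurable_Om : measurable (Om P : set (Leb R d)).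
Hypothesis Om_lty : (leb R d (Om P) < +oo)%E.
Variables (phi psi zeta : sob) (c s : 'I_2 -> sob).
Hypothesis zeta_L2 : L2 (Om P) (fval zeta).
Hypothesis lagr_def : lagrangian_defined P phi c s psi zeta.

Lemma dotC (u v : 'rV[R]_d) : dot u v = dot v u.
Proof. by apply: eq_bigr => i _; rewrite mulrC. Qed.

Lemma dot_affine (a b u : 'rV[R]_d) (t : R) :
  dot (a + t *: b) u = dot a u + t * dot b u.
Proof.
rewrite /dot mulr_sumr -big_split; apply: eq_bigr => i _ /=.
by rewrite !mxE mulrDl mulrA.
Qed.

Lemma fval_affine (u v : sob) (t : R) x :
  fval (u + t *: v) x = fval u x + t * fval v x.
Proof. by []. Qed.

Lemma grad_affine (u v : sob) (t : R) x :
  grad (u + t *: v) x = grad u x + t *: grad v x.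
Proof. by []. Qed.

Lemma family_affine (u v : 'I_2 -> sob) (t : R) i :
  (u + t *: v) i = u i + t *: v i.
Proof. by []. Qed.

(** The integrand of the first adjoint equation, with its flux folded; it agrees with the expanded
    form by conversion. *)
Definition adjoint_density (i : 'I_2) (q : sob) (x : 'rV[R]_d) : R :=
  Dcoef P phi x * dot (grad (s i) x) (flux P i phi q psi x)
  + z R i * fval q x - z R i * fval zeta x * fval q x.

Definition coupling_density (i : 'I_2) (eta : sob) (x : 'rV[R]_d) : R :=
  Dcoef P phi x * z R i * fval (c i) x * dot (grad (s i) x) (grad eta x).

Definition stiffness_density (eta : sob) (x : 'rV[R]_d) : R :=
  epscoef P phi x * dot (grad zeta x) (grad eta x).

(** With the potential fixed, the flux is linear in the concentration, so the slope is the flux of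
    the direction itself. *)
Lemma lagr_flux_affine_w (dw : 'I_2 -> sob) (t : R) i :
  lagr_flux P phi (c + t *: dw) s psi i =
  fun x => lagr_flux P phi c s psi i x + t * lagr_flux P phi dw s psi i x.
Proof.
apply/funext => x; rewrite /lagr_flux.
rewrite (_ : flux P i phi ((c + t *: dw) i) psi x =
    flux P i phi (c i) psi x + t *: flux P i phi (dw i) psi x).
  by rewrite dot_affine; ring.
rewrite family_affine /flux grad_affine fval_affine.
by apply/rowP => j; rewrite !mxE; ring.
Qed.

(** The potential enters the flux only through the drift term [z_i c_i grad tau], which is the
    source of the coupling term. *)
Lemma lagr_flux_affine_tau (dtau : sob) (t : R) i :
  lagr_flux P phi c s (psi + t *: dtau) i =
  fun x => lagr_flux P phi c s psi i x + t * coupling_density i dtau x.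
Proof.
apply/funext => x; rewrite /lagr_flux /coupling_density.
rewrite (_ : flux P i phi (c i) (psi + t *: dtau) x =
    flux P i phi (c i) psi x + (t * (z R i * fval (c i) x)) *: grad dtau x).
  by rewrite dot_affine [dot (grad dtau x) _]dotC; ring.
rewrite /flux grad_affine.
by apply/rowP => j; rewrite !mxE; ring.
Qed.

Lemma charge_density_affine (dw : 'I_2 -> sob) (t : R) x :
  charge_density (c + t *: dw) x = charge_density c x + t * charge_density dw x.
Proof.
rewrite /charge_density.
under eq_bigr => i _ do rewrite family_affine fval_affine mulrDr mulrCA.
by rewrite big_split mulr_sumr.
Qed.

Lemma lagr_poisson_affine_w (dw : 'I_2 -> sob) (t : R) :
  lagr_poisson P phi (c + t *: dw) psi zeta =
  fun x => lagr_poisson P phi c psi zeta x +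
    t * - \sum_(i < 2) z R i * (fval zeta x * fval (dw i) x).
Proof.
apply/funext => x; rewrite /lagr_poisson charge_density_affine.
rewrite (_ : \sum_(i < 2) _ = charge_density dw x * fval zeta x).
  by move: (charge_density c x) (charge_density dw x) => a b; ring.
by rewrite mulr_suml; apply: eq_bigr => i _; rewrite mulrA mulrAC.
Qed.

Lemma lagr_poisson_affine_tau (dtau : sob) (t : R) :
  lagr_poisson P phi c (psi + t *: dtau) zeta =
  fun x => lagr_poisson P phi c psi zeta x + t * stiffness_density dtau x.
Proof.
apply/funext => x; rewrite /lagr_poisson /stiffness_density.
by rewrite grad_affine dot_affine [dot (grad dtau x) _]dotC; ring.
Qed.

(** Separates the flux from the terms whose integrability follows from the L^2 bounds. *)
Lemma adjoint_densityE i (q : sob) : adjoint_density i q =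
  fun x => lagr_flux P phi (fun=> q) s psi i x +
    (z R i * fval q x - z R i * (fval zeta x * fval q x)).
Proof.
apply/funext => x; rewrite /adjoint_density /lagr_flux dotC; ring.
Qed.

Lemma adjoint_density0 i : adjoint_density i 0 = fun=> 0.
Proof.
apply/funext => x; rewrite /adjoint_density.
rewrite (_ : fval 0 x = 0)// (_ : flux P i phi 0 psi x = 0).
  rewrite /dot big1 => [|j _]; first by rewrite !mulr0 addr0 subr0.
  by rewrite mxE mulr0.
rewrite /flux (_ : fval 0 x = 0)// (_ : grad 0 x = 0)// !mulr0 !scale0r.
by rewrite addr0 subr0.
Qed.

Section ConcentrationDirection.
Variable dw : 'I_2 -> sob.
Hypothesis dw_L2 : forall i, L2 (Om P) (fval (dw i)).

Let zw_int i : integrable_on (Om P) (fun x => z R i * fval (dw i) x).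
Proof. exact/integrable_onZ/L2_integrable. Qed.

Let zzw_int i :
  integrable_on (Om P) (fun x => z R i * (fval zeta x * fval (dw i) x)).
Proof. exact/integrable_onZ/L2_mul_integrable. Qed.

Lemma lagr_flux_integrable_of_defined t : t != 0 ->
  lagrangian_defined P phi (c + t *: dw) s psi zeta ->
  forall i, integrable_on (Om P) (lagr_flux P phi dw s psi i).
Proof.
move=> t0 [_ fluxt _] i; have [_ fluxc _] := lagr_def.
apply: (integrable_on_increment measurable_Om t0 (fluxc i)).
by rewrite -lagr_flux_affine_w.
Qed.

(** The two integrands differ by [z_i q - z_i zeta q], which is integrable because [q] and [zeta]
    are in L^2 and the domain has finite measure. *)
Lemma adjoint_density_integrable i :
  integrable_on (Om P) (lagr_flux P phi dw s psi i) <->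
  integrable_on (Om P) (adjoint_density i (dw i)).
Proof.
have rest := integrable_onB measurable_Om (zw_int i) (zzw_int i).
rewrite adjoint_densityE; split=> [dwU|adjU]; first exact: integrable_onD.
rewrite (_ : lagr_flux P phi dw s psi i = fun x =>
   (lagr_flux P phi (fun=> dw i) s psi i x +
    (z R i * fval (dw i) x - z R i * (fval zeta x * fval (dw i) x)))
   - (z R i * fval (dw i) x - z R i * (fval zeta x * fval (dw i) x))).
  exact: integrable_onB.
by apply/funext => x; rewrite addrK.
Qed.

(** The derivative is minus the sum over both species of the left-hand sides of the first adjoint
    equation. *)
Lemma lagrangian_gateaux_w :
  (forall i, integrable_on (Om P) (lagr_flux P phi dw s psi i)) ->
  is_gateaux (fun w => lagrangian_defined P phi w s psi zeta)
    (fun w => lagrangian P phi w s psi zeta) c dw 0 <->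
  \sum_(i < 2) integral_on (Om P) (adjoint_density i (dw i)) = 0.
Proof.
move=> dw_flux; have [zc fluxc poissonc] := lagr_def.
have zwE (t : R) i : (fun x => z R i * fval ((c + t *: dw) i) x) =
    fun x => z R i * fval (c i) x + t * (z R i * fval (dw i) x).
  by apply/funext => x; rewrite family_affine fval_affine mulrDr mulrCA.
have zz_int : integrable_on (Om P)
    (fun x => - \sum_(i < 2) z R i * (fval zeta x * fval (dw i) x)).
  under eq_fun do rewrite -mulN1r.
  by apply: integrable_onZ => //; exact: integrable_on_sum.
rewrite (is_gateaux_affine
  (k := - \sum_(i < 2) integral_on (Om P) (adjoint_density i (dw i)))).
- by split=> [/esym/eqP|->]; rewrite ?oppr0// oppr_eq0 => /eqP.
- move=> t; split=> [i|i|].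
  + by rewrite zwE; exact: integrable_on_affine.
  + by rewrite lagr_flux_affine_w; exact: integrable_on_affine.
  + by rewrite lagr_poisson_affine_w; exact: integrable_on_affine.
move=> t; rewrite /lagrangian /Jobj.
have -> : \sum_(i < 2) integral_on (Om P)
      (fun x => z R i * fval ((c + t *: dw) i) x) =
    \sum_(i < 2) integral_on (Om P) (fun x => z R i * fval (c i) x) +
    t * \sum_(i < 2) integral_on (Om P) (fun x => z R i * fval (dw i) x).
  under eq_bigr => i _ do rewrite zwE (integral_on_affine measurable_Om)//.
  by rewrite big_split mulr_sumr.
have -> : \sum_(i < 2) integral_on (Om P)
      (lagr_flux P phi (c + t *: dw) s psi i) =
    \sum_(i < 2) integral_on (Om P) (lagr_flux P phi c s psi i) +
    t * \sum_(i < 2) integral_on (Om P) (lagr_flux P phi dw s psi i).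
  under eq_bigr => i _ do
    rewrite lagr_flux_affine_w (integral_on_affine measurable_Om)//.
  by rewrite big_split mulr_sumr.
have -> : integral_on (Om P) (lagr_poisson P phi (c + t *: dw) psi zeta) =
    integral_on (Om P) (lagr_poisson P phi c psi zeta) + t *
    - \sum_(i < 2) integral_on (Om P)
        (fun x => z R i * (fval zeta x * fval (dw i) x)).
  rewrite lagr_poisson_affine_w integral_on_affine//; congr (_ + _ * _).
  under eq_fun do rewrite -mulN1r.
  rewrite integral_onZ// ?mulN1r ?integral_on_sum//; exact: integrable_on_sum.
have -> : \sum_(i < 2) integral_on (Om P) (adjoint_density i (dw i)) =
    \sum_(i < 2) integral_on (Om P) (lagr_flux P phi dw s psi i) +
    (\sum_(i < 2) integral_on (Om P) (fun x => z R i * fval (dw i) x) -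
     \sum_(i < 2) integral_on (Om P)
        (fun x => z R i * (fval zeta x * fval (dw i) x))).
  rewrite -sumrB -big_split; apply: eq_bigr => i _ /=.
  rewrite adjoint_densityE integral_onD; [|exact: measurable_Om|exact: dw_flux|].
    by rewrite integral_onB.
  exact: integrable_onB.
(* Here [a], [b], [p] are the objective, flux and Poisson integrals at [c], and the primes mark
   their slopes; the Poisson slope is [- p'] because the charge density enters that integrand with a
   minus sign. *)
have collect (a b p a' b' p' : R) : - (a + t * a') - (b + t * b') - (p + t * - p')
  = - a - b - p + t * - (b' + (a' - p')) by ring.
exact: collect.
Qed.

End ConcentrationDirection.

Section PotentialDirection.
Variable dtau : sob.

Lemma densities_integrable_of_defined t : t != 0 ->
  lagrangian_defined P phi c s (psi + t *: dtau) zeta ->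
  integrable_on (Om P) (stiffness_density dtau) /\
  forall i, integrable_on (Om P) (coupling_density i dtau).
Proof.
move=> t0 [_ fluxt poissont]; have [_ fluxc poissonc] := lagr_def.
split=> [|i].
  apply: (integrable_on_increment measurable_Om t0 poissonc).
  by rewrite -lagr_poisson_affine_tau.
apply: (integrable_on_increment measurable_Om t0 (fluxc i)).
by rewrite -lagr_flux_affine_tau.
Qed.

(** The objective is independent of the potential, so the derivative is minus the stiffness and
    coupling integrals. *)
Lemma lagrangian_gateaux_tau :
  integrable_on (Om P) (stiffness_density dtau) ->
  (forall i, integrable_on (Om P) (coupling_density i dtau)) ->
  is_gateaux (fun tau => lagrangian_defined P phi c s tau zeta)
    (fun tau => lagrangian P phi c s tau zeta) psi dtau 0 <->
  integral_on (Om P) (stiffness_density dtau) +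
    \sum_(i < 2) integral_on (Om P) (coupling_density i dtau) = 0.
Proof.
move=> stiff coupl; have [zc fluxc poissonc] := lagr_def.
rewrite (is_gateaux_affine (k := - (integral_on (Om P) (stiffness_density dtau) +
    \sum_(i < 2) integral_on (Om P) (coupling_density i dtau)))).
- by split=> [/esym/eqP|->]; rewrite ?oppr0// oppr_eq0 => /eqP.
- move=> t; split=> // [i|].
  + by rewrite lagr_flux_affine_tau; exact: integrable_on_affine.
  + by rewrite lagr_poisson_affine_tau; exact: integrable_on_affine.
move=> t; rewrite /lagrangian lagr_poisson_affine_tau integral_on_affine//.
have -> : \sum_(i < 2) integral_on (Om P)
      (lagr_flux P phi c s (psi + t *: dtau) i) =
    \sum_(i < 2) integral_on (Om P) (lagr_flux P phi c s psi i) +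
    t * \sum_(i < 2) integral_on (Om P) (coupling_density i dtau).
  under eq_bigr => i _ do
    rewrite lagr_flux_affine_tau (integral_on_affine measurable_Om)//.
  by rewrite big_split mulr_sumr.
by ring.
Qed.

End PotentialDirection.

End LagrangianDerivatives.

(** * Equivalence of stationarity with the explicit adjoint equations *)

Theorem lemma3p1 (R : realType) (d : nat) (hd : d = 2%N \/ d = 3%N)
  (P : pnp_data R d) (hP : pnp_hyp P)
  (phi : sob R d) (hphi : admissible P phi)
  (c : 'I_2 -> sob R d) (psi : sob R d) (hstate : state_system P phi c psi)
  (s : 'I_2 -> sob R d) (zeta : sob R d)
  (hs : forall i, H1d0 P (s i)) (hzeta : H1d0 P zeta) :
  adjoint_system P phi c psi s zeta <->
  (forall (i : 'I_2) (q : sob R d), H1d0 P q ->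
     integral_eq0 (Om P) (fun x =>
       Dcoef P phi x *
         dot (grad (s i) x)
             (grad q x + (z R i * fval q x) *: grad psi x
              - (alpha0 P * fval q x) *: grad phi x)
       + z R i * fval q x - z R i * fval zeta x * fval q x)) /\
  (forall eta : sob R d, H1d0 P eta ->
     integrable_on (Om P) (fun x =>
       epscoef P phi x * dot (grad zeta x) (grad eta x)) /\
     (forall i : 'I_2, integrable_on (Om P) (fun x =>
       Dcoef P phi x * z R i * fval (c i) x * dot (grad (s i) x) (grad eta x))) /\
     integral_on (Om P) (fun x =>
       epscoef P phi x * dot (grad zeta x) (grad eta x))
     + \sum_(i < 2) integral_on (Om P) (fun x =>
         Dcoef P phi x * z R i * fval (c i) x * dot (grad (s i) x) (grad eta x))
     = 0).
Proof.
have mOm := leb_measurable_open (Om_open hP).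
have Om_lty := leb_bounded_lty (Om_bounded hP).
have [hc _ flux0 poisson0] := hstate.
have zeta_L2 : L2 (Om P) (fval zeta) by have [[]] := hzeta.
have d0_L2 q : H1d0 P q -> L2 (Om P) (fval q) by move=> [[]].
(* The state equations tested with the multipliers [s i] and [zeta] supply the integrability of the
   flux and Poisson terms. *)
have lagr_def : lagrangian_defined P phi c s psi zeta.
  split=> [i|i|]; last by have [] := poisson0 _ hzeta.
    apply: integrable_onZ => //; apply: L2_integrable => //.
    by have [[]] := hc i.
  by have [] := flux0 i _ (hs i).
split.
  move=> [adj_w adj_tau]; split=> [i q hq|eta heta].
    (* Testing with q in the i-th slot only decouples the two species. *)
    pose dw j : sob R d := if j == i then q else 0.
    have hdw j : H1d0 P (dw j).
      by rewrite /dw; case: eqP => _; [exact: hq|exact: H1d0_0].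
    have dw_L2 j := d0_L2 _ (hdw j).
    (* A second point where the Lagrangian is defined; with [c] it yields the integrability of the
       slopes. *)
    have [t t0 deft] := is_gateaux_def (adj_w _ hdw).
    have dw_flux := lagr_flux_integrable_of_defined mOm lagr_def t0 deft.
    have /(lagrangian_gateaux_w mOm Om_lty zeta_L2 lagr_def dw_L2 dw_flux) :=
      adj_w _ hdw.
    rewrite (bigD1 i)//= big1 => [|j /negbTE ji]; last first.
      by rewrite /dw ji adjoint_density0; exact: integral_on0.
    rewrite /dw eqxx addr0 => adj0; split=> //.
    have := (adjoint_density_integrable mOm Om_lty phi psi s zeta_L2 dw_L2 i).1
      (dw_flux i).
    by rewrite /dw eqxx.
  have [t t0 deft] := is_gateaux_def (adj_tau _ heta).
  have [stiff coupl] := densities_integrable_of_defined mOm lagr_def t0 deft.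
  split=> //; split=> //.
  by have /(lagrangian_gateaux_tau mOm lagr_def stiff coupl) := adj_tau _ heta.
move=> [adj_w adj_tau]; split=> [dw hdw|dtau hdtau].
  (* Conversely, the equation for each species, tested with [dw i], gives both integrability and a
     vanishing summand. *)
  have dw_L2 j := d0_L2 _ (hdw j).
  apply/(lagrangian_gateaux_w mOm Om_lty zeta_L2 lagr_def dw_L2) => [i|].
    apply/(adjoint_density_integrable mOm Om_lty phi psi s zeta_L2 dw_L2 i).
    by have [] := adj_w i _ (hdw i).
  by apply: big1 => i _; have [] := adj_w i _ (hdw i).
have [stiff [coupl sum0]] := adj_tau _ hdtau.
exact/(lagrangian_gateaux_tau mOm lagr_def stiff coupl).
Qed.
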